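(* Let $s$ be a non-empty string of length $n$ over a finite alphabet $\Sigma$, and let $\sigma$ be the number of distinct characters occurring in $s$. Then $\mathit{PS}(s) < \sigma n$, where $\mathit{PS}(s)$ is the number of non-equivalent parameterized squares occurring in $s$.
   Context: Two strings $x,y$ of equal length $k$ over $\Sigma$ are parameterized equivalent, written $x \approx y$, if there is a bijection $f:\Sigma\to\Sigma$ with $f(x[i]) = y[i]$ for all $1 \le i \le k$. A string $w$ is a parameterized square if $w = xy$ for strings $x,y$ with $x \approx y$ (in particular every ordinary square $xx$ is a parameterized square). Let $\mathsf{PS}(s)$ be the set of all parameterized squares that are substrings of $s$, and let $\mathit{PS}(s)$ be the number of equivalence classes of $\mathsf{PS}(s)$ under $\approx$. *)

(* Defs.v *)
From mathcomp Require Import all_boot fingroup perm.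

Set Implicit Arguments.
Unset Strict Implicit.
Unset Printing Implicit Defensive.

(* Parameterized equivalence: as [map] preserves sizes, [map f x = y] says that *)
(* x and y have the same length and that f x[i] = y[i] at every position i.     *)
Definition param_equiv (Sigma : finType) (x y : seq Sigma) : bool :=
  [exists f : {perm Sigma}, map f x == y].

Lemma param_equivP (Sigma : finType) (x y : seq Sigma) :
  reflect (exists2 f : Sigma -> Sigma, bijective f & map f x = y)
          (param_equiv x y).
Proof.
apply: (iffP existsP) => [[f /eqP <-]|[f /bij_inj f_inj <-]].
  by exists f => //; exists (f^-1)%g; [apply: permK | apply: permKV].
by exists (perm f_inj); apply/eqP/eq_map => c; rewrite permE.
Qed.

Lemma param_equiv_equivalence (Sigma : finType) :
  equivalence_rel (@param_equiv Sigma).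
Proof.
have refl x : @param_equiv Sigma x x.
  by apply/param_equivP; exists id; [exists id | rewrite map_id].
have sym x y : @param_equiv Sigma x y -> param_equiv y x.
  case/param_equivP=> f [g fK gK] <-; apply/param_equivP.
  by exists g; [exists f | rewrite mapK].
have trans x y z : @param_equiv Sigma x y -> param_equiv y z -> param_equiv x z.
  case/param_equivP=> f bij_f <- /param_equivP[g bij_g <-]; apply/param_equivP.
  by exists (g \o f); [apply: bij_comp | rewrite map_comp].
move=> x y z; split=> // xy; apply/idP/idP; last exact: trans.
by apply: trans; apply: sym.
Qed.

(* The splits w = x ++ y are exactly the pairs (take i w, drop i w). Squares are *)
(* nonempty: the empty word is not counted.                                     *)
Definition param_square (Sigma : finType) (w : seq Sigma) : bool :=
  (w != [::]) &&
  [exists i : 'I_(size w).+1, param_equiv (take i w) (drop i w)].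

Lemma param_squareP (Sigma : finType) (w : seq Sigma) :
  reflect (w <> [::] /\
           exists x y : seq Sigma, w = x ++ y /\ param_equiv x y)
          (param_square w).
Proof.
apply: (iffP andP) => -[w_neq0].
  case/existsP=> i eq_i; split; first exact/eqP.
  by exists (take i w), (drop i w); rewrite cat_take_drop.
case=> x [y [Dw eq_xy]]; split; first exact/eqP.
have lt_x : size x < (size w).+1 by rewrite Dw size_cat ltnS leq_addr.
apply/existsP; exists (Ordinal lt_x) => /=.
by rewrite [in take _ _]Dw [in drop _ _]Dw take_size_cat ?drop_size_cat.
Qed.

(* Substrings of s have length at most [size s], so no square is lost by ranging *)
(* over the finite type of strings of bounded length.                           *)
Definition param_squares_of (Sigma : finType) (s : seq Sigma) :
    {set (size s).-bseq Sigma} :=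
  [set w : (size s).-bseq Sigma | infix w s & param_square w].

Lemma param_squares_ofP (Sigma : finType) (s w : seq Sigma) :
  reflect (exists2 b : (size s).-bseq Sigma,
             b \in param_squares_of s & w = b :> seq Sigma)
          (infix w s && param_square w).
Proof.
apply: (iffP andP) => [[w_s sq_w]|[b + ->]]; last by rewrite inE => /andP.
have le_w : size w <= size s by apply: size_infix.
by exists (Bseq le_w); rewrite // inE w_s.
Qed.

Definition num_param_squares (Sigma : finType) (s : seq Sigma) : nat :=
  #|equivalence_partition
      (fun u v : (size s).-bseq Sigma => param_equiv u v)
      (param_squares_of s)|.

(* Main.v *)
(* At each position at most #|C| classes, C being the set of letters of s, have *)
(* their last occurrence there, and none has it at the last position.  Suppose   *)
(* that squares of half-lengths p_0 < ... < p_#|C| start at one position.  If    *)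
(* p_#|C| >= 2 p_0, the shortest square recurs at distance p_#|C|.  Otherwise    *)
(* let d be the smallest gap p_(k+1) - p_k: comparing these two squares, the     *)
(* prefix of length p_k is parameterized d-periodic, and the p_j-squares copy    *)
(* periodic prefixes to distance p_j.  The period maps are conjugate             *)
(* permutations of C, hence of the same parity, so they coincide once they agree *)
(* on all but two letters; therefore two d-periodic runs merge as soon as they   *)
(* overlap by (#|C| - 1) d.  Repeated merging makes the prefix of length         *)
(* 2 p_0 + d periodic, and the shortest square recurs at distance d.             *)

Require Import Defs.
From mathcomp Require Import all_boot fingroup perm zify.

Set Implicit Arguments.
Unset Strict Implicit.
Unset Printing Implicit Defensive.

(** Each class is charged to the position of its last occurrence, where the half-length determines
    it ([last_square_class]). [card_last_square_at] allows at most [#|C|] charges per position, and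
    the final position receives none. The bound per position rests on [square_recurs]: of [#|C| + 1]
    squares with a common start, the shortest has an equivalent factor further right. That factor
    comes from growing a parameterized [d]-periodic prefix letter by letter: [prun_image] copies
    runs along the squares and [prun_merge] glues the copies. *)

(** * Permutations of the letters in use *)

(** Trades a bijection of the whole alphabet for one of the occurring letters, so that only [#|C|]
    enters the count. *)
Lemma perm_on_extend (Sigma : finType) (C : {set Sigma}) (g : {perm Sigma})
    (x : seq Sigma) :
  {subset x <= C} -> {subset map g x <= C} ->
  exists2 f : {perm Sigma}, perm_on C f & map f x = map g x.
Proof.
elim: x => [|a x IHx] /= xC gxC; first by exists 1%g => //; apply: perm_on1.
have [||f Cf fx] := IHx.
- by move=> z zx; apply: xC; rewrite inE zx orbT.
- by move=> z zx; apply: gxC; rewrite inE zx orbT.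
have fg z : z \in x -> f z = g z by move/eq_in_map: fx; apply.
have [ax|ax] := boolP (a \in x); first by exists f; rewrite // fg // fx.
have aC : a \in C by apply: xC; rewrite mem_head.
have gaC : g a \in C by apply: gxC; rewrite mem_head.
(* The swap corrects the value at [a] only: by injectivity no letter of [x] is sent to [f a] or
   [g a]. *)
exists (f * tperm (f a) (g a))%g.
  apply: perm_onM => //; apply/subsetP=> z; rewrite inE.
  by case: tpermP => [->|->|]; rewrite ?eqxx // (perm_closed _ Cf).
congr (_ :: _); first by rewrite permM tpermL.
apply/eq_in_map=> z zx; rewrite permM.
have az : a != z by apply: contraNneq ax => ->.
by rewrite tpermD ?(inj_eq perm_inj) // fg // (inj_eq perm_inj).
Qed.

(** The quotient of [f] and [g] moves at most two letters, so it is trivial or a transposition, and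
    a transposition is odd. *)
Lemma perm_eq_parity (Sigma : finType) (C D : {set Sigma})
    (f g : {perm Sigma}) :
  perm_on C f -> perm_on C g -> odd_perm f = odd_perm g ->
  {in D, f =1 g} -> #|C :\: D| <= 2 -> f = g.
Proof.
move=> Cf Cg odd_fg fgD cardCD; apply/eqP; rewrite eq_mulgV1.
set h := (f * g^-1)%g.
have hCD : perm_on (C :\: D) h.
  apply/subsetP=> z; rewrite !inE => hz; apply/andP; split.
    by apply: contraNN hz => /fgD fgz; rewrite permM fgz permK.
  apply: contraR hz => zC.
  by rewrite permM (out_perm Cf zC) (out_perm (perm_onV Cg) zC).
have even_h : odd_perm h = false by rewrite odd_permM odd_permV odd_fg addbb.
apply: contraFT even_h => h1.
have [x hx] : exists x, h x != x.
  apply/existsP; apply: contraNT h1; rewrite negb_exists => /forallP fix_h.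
  apply/eqP/permP=> x; rewrite perm1; apply/eqP.
  by have := fix_h x; rewrite negbK.
have xCD : x \in C :\: D by apply: (subsetP hCD).
have hxCD : h x \in C :\: D by rewrite (perm_closed _ hCD).
have DCD : [set x; h x] = C :\: D.
  apply/eqP; rewrite eqEcard cards2 eq_sym hx cardCD andbT.
  by apply/subsetP=> z /set2P[]->.
have hE z : z \in [set x; h x] -> h z \in [set x; h x].
  by rewrite DCD (perm_closed _ hCD).
have hhx : h (h x) = x.
  have /set2P[//|/perm_inj hxx] := hE _ (set22 x (h x)).
  by rewrite hxx eqxx in hx.
suff -> : h = tperm x (h x) by rewrite odd_tperm eq_sym.
apply/permP=> z; case: tpermP => [->|->|zx zhx] //.
by apply: (out_perm hCD); rewrite -DCD !inE; apply/norP; split; apply/eqP.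
Qed.

(** * Parameterized periodic runs *)

(* The parity b is part of the definition because merging two runs whose maps *)
(* are only known to agree on all but two letters relies on it.               *)
Definition prun (Sigma : finType) (C : {set Sigma}) (w : nat -> Sigma)
    (b : bool) (d u v : nat) : Prop :=
  exists pi : {perm Sigma}, [/\ perm_on C pi, odd_perm pi = b &
    forall t, u <= t -> t + d < v -> w (t + d) = pi (w t)].

Lemma prun_sub (Sigma : finType) (C : {set Sigma}) (w : nat -> Sigma)
    (b : bool) (d u v u' v' : nat) :
  u <= u' -> v' <= v -> prun C w b d u v -> prun C w b d u' v'.
Proof.
move=> uu' vv' [pi [Cpi odd_pi per]]; exists pi; split=> // t ut tv.
by apply: per; lia.
Qed.

(** Inside the overlap both maps send [w t] to [w (t + d)]. Beyond it, the [#|C| - 2] letters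
    preceding [w t] in steps of [d] either include [w t] or are distinct, and then parity forces
    equality of the maps. The bound [u' + d <= v] matters when [#|C| = 1]. *)
Lemma prun_merge (Sigma : finType) (C : {set Sigma}) (w : nat -> Sigma)
    (b : bool) (d u v u' v' : nat) :
  (forall t, w t \in C) -> 0 < d -> u <= u' ->
  u' + d <= v -> u' + #|C|.-1 * d <= v ->
  prun C w b d u v -> prun C w b d u' v' -> prun C w b d u v'.
Proof.
move=> wC d_gt0 uu' ov1 ov [f [Cf odd_f perf]] [g [Cg odd_g perg]].
have fg t : u' <= t -> t + d < v' -> f (w t) = g (w t).
  elim/ltn_ind: t => t IHt ut tv'.
  have [tv|vt] := ltnP (t + d) v; first by rewrite -perf ?perg //; lia.
  pose D := [seq w (t - i * d) | i <- iota 1 (#|C| - 2)].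
  have back i : 0 < i -> i <= #|C| - 2 -> u' + i * d <= t.
    move=> i_gt0 iC; have: i * d + d <= #|C|.-1 * d; last by lia.
    by rewrite -mulSnr leq_mul2r; apply/orP; right; lia.
  have fgD : {in D, f =1 g}.
    move=> _ /mapP[i + ->]; rewrite mem_iota => i_C.
    have uti : u' + i * d <= t by apply: back; lia.
    have : 0 < i * d by rewrite muln_gt0 d_gt0; lia.
    by move=> id_gt0; apply: IHt; lia.
  have iter_g i j : u' + (i + j) * d <= t ->
      w (t - j * d) = iter i g (w (t - (i + j) * d)).
    elim: i => [|i IHi] // uij; rewrite mulnDl mulSn in uij.
    rewrite iterSr IHi mulnDl; last by lia.
    by rewrite -perg ?mulnDl ?mulSn; [congr (iter i g (w _)) | |]; lia.
  have [/fgD //|wtD] := boolP (w t \in D).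
  suff -> : f = g by [].
  apply: (perm_eq_parity (C := C) (D := [set c in D])) => //.
  - by rewrite odd_f odd_g.
  - by move=> c; rewrite inE; apply: fgD.
  (* If [w (t - i * d) = w (t - j * d)] with [i < j], applying [g] to both [i] times puts [w t] in
     [D]. *)
  have uniqD : uniq D.
    rewrite map_inj_in_uniq ?iota_uniq // => i j.
    rewrite !mem_iota => i_C j_C.
    wlog ij : i j i_C j_C / i < j => [wlog_ij wij|wij].
      by case: (ltngtP i j) => // ij; [|symmetry]; apply: wlog_ij.
    case/negP: wtD; apply/mapP; exists (j - i); first by rewrite mem_iota; lia.
    have tj : u' + j * d <= t by apply: back; lia.
    have := iter_g i 0; rewrite mul0n subn0 addn0 => ->; last first.
      by apply: back; lia.
    by rewrite wij (iter_g i (j - i)) ?subnKC // ltnW.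
  have DC : [set c in D] \subset C.
    by apply/subsetP=> c; rewrite inE => /mapP[i _ ->].
  rewrite cardsD (setIidPr DC) cardsE (card_uniqP uniqD) size_map size_iota.
  lia.
exists f; split=> // t ut tv'.
have [tv|vt] := ltnP (t + d) v; first exact: perf.
by rewrite fg ?perg //; lia.
Qed.

(** Renaming by [f] conjugates the period map, which preserves its parity; hence one [b] serves all
    copies. *)
Lemma prun_image (Sigma : finType) (C : {set Sigma}) (w : nat -> Sigma)
    (b : bool) (d p v : nat) (f : {perm Sigma}) :
  perm_on C f -> (forall t, t < p -> w (p + t) = f (w t)) -> v <= p ->
  prun C w b d 0 v <-> prun C w b d p (p + v).
Proof.
move=> Cf fw vp; split=> -[g [Cg odd_g perg]].
  exists (g ^ f)%g; split; first by rewrite !perm_onM ?perm_onV.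
    by rewrite odd_permJ.
  move=> t pt tv; have -> : t = p + (t - p) by lia.
  by rewrite -addnA !fw ?perg ?permJ //; lia.
exists (g ^ f^-1)%g; split; first by rewrite !perm_onM ?perm_onV.
  by rewrite odd_permJ.
move=> t _ tv; apply: (@perm_inj _ f); rewrite -fw; last by lia.
rewrite addnA perg; try lia.
by rewrite fw ?conjgE ?invgK ?permM ?permKV //; lia.
Qed.

(** * Recurrence of the shortest square *)

(** The bound on [d] keeps the new copy within the longest square, hence within the string. *)
Lemma square_recurs (Sigma : finType) (C : {set Sigma}) (w : nat -> Sigma)
    (p : nat -> nat) :
  (forall t, w t \in C) ->
  (forall j, j < #|C| -> p j < p j.+1) -> 0 < p 0 ->
  (forall j, j <= #|C| -> exists2 f : {perm Sigma}, perm_on C f &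
     forall t, t < p j -> w (p j + t) = f (w t)) ->
  exists d, [/\ 0 < d, d + (p 0).*2 <= (p #|C|).*2 &
    exists f : {perm Sigma}, forall t, t < (p 0).*2 -> w (d + t) = f (w t)].
Proof.
move=> wC p_incr p0_gt0 sq; set n := #|C|.
have n_gt0 : 0 < n by apply/card_gt0P; exists (w 0).
have [p0n|pn0] := leqP (p 0).*2 (p n).
  have [f _ fw] := sq n (leqnn _); exists (p n); split; try lia.
  by exists f => t tp; rewrite fw //; lia.
(* Two letters are needed for [d <= n.-1 * d], which every merge below relies on. *)
have [n_gt1|n1] := ltnP 1 n; last first.
  have /cards1P[c DC] : #|C| == 1 by rewrite -/n; lia.
  have wc t : w t = c by apply/set1P; rewrite -DC.
  exists 1; split=> //; first by have := p_incr 0 n_gt0; have -> : n = 1; lia.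
  by exists 1%g => t _; rewrite perm1 !wc.
have [k gap_min] : exists k : 'I_n, forall j : 'I_n,
    p k.+1 - p k <= p j.+1 - p j.
  by case: (arg_minnP (fun j : 'I_n => p j.+1 - p j) (P := predT) 
    (i0 := Ordinal n_gt0)) => // k _ min; exists k => j; apply: min.
set d := p k.+1 - p k in gap_min.
have kn := ltn_ord k; have pk := p_incr k kn.
have d_gt0 : 0 < d by rewrite /d; lia.
have gap i j : i + j <= n -> p i + j * d <= p (i + j).
  elim: j => [|j IHj] ijn; first by rewrite addn0 mul0n addn0.
  have lt_ij : i + j < n by lia.
  have := gap_min (Ordinal lt_ij); have := p_incr _ lt_ij => /=.
  by have := IHj ltac:(lia); rewrite addnS mulSn; lia.
have p_le i j : i <= j -> j <= n -> p i <= p j.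
  move=> ij jn; have := gap i (j - i); rewrite subnKC // => /(_ jn).
  exact: leq_trans (leq_addr _ _).
have [f Cf fw] := sq k (ltnW kn); have [g Cg gw] := sq k.+1 kn.
pose b := odd_perm (g * f^-1)%g.
(* For [t + d < p k], [f (w (t + d)) = w (p k.+1 + t) = g (w t)]. *)
have run_k : prun C w b d 0 (p k).
  exists (g * f^-1)%g; split; rewrite ?perm_onM ?perm_onV // => t _ tk.
  rewrite permM -gw; last by lia.
  apply: (@perm_inj _ f); rewrite permKV -fw //.
  by congr w; rewrite /d; lia.
suff: prun C w b d 0 ((p 0).*2 + d).
  case=> h [_ _ hw]; exists d; split=> //.
    have := gap 0 n (leqnn n); rewrite add0n.
    by have := leq_pmull d n_gt0; lia.
  by exists h => t tp; rewrite addnC hw //; lia.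
have image j v : j <= n -> v <= p j ->
    prun C w b d 0 v <-> prun C w b d (p j) (p j + v).
  by move=> jn vp; have [h Ch hw] := sq j jn; exact: (prun_image b d Ch hw vp).
have dn : d <= n.-1 * d by rewrite leq_pmull //; lia.
have p0k : p 0 <= p k by apply: p_le => //; apply: ltnW.
have := gap 0 n.-1 (leq_pred n); rewrite add0n => gap0.
suff step N : p k <= N -> N < (p 0).*2 + d ->
    prun C w b d 0 N -> prun C w b d 0 N.+1.
  have grow j : p k + j <= (p 0).*2 + d -> prun C w b d 0 (p k + j).
    elim: j => [|j IHj] jn; first by rewrite addn0.
    by rewrite addnS; apply: step; [lia | lia | apply: IHj; lia].
  have pkn := p_le k n (ltnW kn) (leqnn n).
  by apply: (prun_sub (leqnn 0) _ (grow ((p 0).*2 + d - p k) _)); lia.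
move=> kN Nd runN; have [pN|Np] := leqP (p n.-1) N.
  have run_p j : j <= n -> p j <= N -> prun C w b d (p j) (p j + p j).
    by move=> jn jN; apply/image => //; apply: prun_sub runN.
  have [p0N|Np0] := leqP (p 0).*2 N.
    (* Overlap: [p 1 + n.-1 * d <= p n < (p 0).*2 <= N]. Reach: [p 1 >= p 0 + d], so
       [(p 1).*2 > N]. *)
    have := gap 1 n.-1; rewrite add1n prednK // => /(_ (leqnn n)) gap1.
    have p1n : p 1 <= p n by apply: p_le.
    apply: (prun_sub (leqnn 0) _ (prun_merge wC d_gt0 _ _ _ runN
      (run_p 1 n_gt0 _))); rewrite -/n; try lia.
    by have := gap 0 1 n_gt0; rewrite add0n; lia.
  (* Overlap: [p 0 + n.-1 * d <= p n.-1 <= N]. *)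
  by apply: (prun_sub (leqnn 0) _ (prun_merge wC d_gt0 _ _ _ runN
    (run_p 0 _ _))); rewrite -/n; lia.
(* The copies of the prefix at [p n.-1] and [p n] merge, and the result is pulled back: [p n + n.-1
   * d < p 0 + p n.-1 <= N + p n.-1]. *)
have pn : p n.-1 <= p n by apply: p_le => //; apply: leq_pred.
apply/(image n.-1); rewrite ?leq_pred //.
apply: (prun_sub (leqnn _) _ (prun_merge wC d_gt0 pn _ _
  (proj1 (image n.-1 N _ _) runN) (proj1 (image n N _ _) runN)));
  rewrite -/n ?leq_pred //; try lia.
by have := p_incr n.-1; rewrite -/n prednK // => /(_ (leqnn _)); lia.
Qed.

(** * Last occurrences of squares *)

Definition factor (Sigma : finType) (s : seq Sigma) (i l : nat) : seq Sigma :=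
  take l (drop i s).

Lemma size_factor (Sigma : finType) (s : seq Sigma) (i l : nat) :
  i + l <= size s -> size (factor s i l) = l.
Proof. by move=> il; rewrite size_takel // size_drop; lia. Qed.

Lemma nth_factor (Sigma : finType) (x0 : Sigma) (s : seq Sigma) (i l t : nat) :
  t < l -> nth x0 (factor s i l) t = nth x0 s (i + t).
Proof. by move=> tl; rewrite nth_take // nth_drop. Qed.

Lemma factor_cat (Sigma : finType) (s : seq Sigma) (i p : nat) :
  factor s i p.*2 = factor s i p ++ factor s (i + p) p.
Proof. by rewrite /factor -addnn takeD drop_drop [p + i]addnC. Qed.

Lemma factor_mem (Sigma : finType) (s : seq Sigma) (i l : nat) :
  {subset factor s i l <= [set c in s]}.
Proof. by move=> c /mem_take/mem_drop cs; rewrite inE. Qed.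

Definition square_at (Sigma : finType) (s : seq Sigma) (i p : nat) : bool :=
  [&& 0 < p, i + p.*2 <= size s &
      param_equiv (factor s i p) (factor s (i + p) p)].

Definition last_square_at (Sigma : finType) (s : seq Sigma) (i p : nat) :
    bool :=
  square_at s i p &&
  [forall j : 'I_(size s), (i < j) ==> (j + p.*2 <= size s) ==>
     ~~ param_equiv (factor s i p.*2) (factor s j p.*2)].

Lemma square_at_perm (Sigma : finType) (x0 : Sigma) (s : seq Sigma)
    (i p : nat) :
  square_at s i p -> exists2 f : {perm Sigma}, perm_on [set c in s] f &
    forall t, t < p -> nth x0 s (i + (p + t)) = f (nth x0 s (i + t)).
Proof.
case/and3P=> _ ip /existsP[g /eqP gE].
have [||f Cf fg] := @perm_on_extend _ [set c in s] g (factor s i p).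
- exact: factor_mem.
- by rewrite gE; apply: factor_mem.
exists f => // t tp; rewrite addnA -!(nth_factor x0 _ _ tp) -gE -fg.
by rewrite (nth_map x0) // size_factor //; lia.
Qed.

Lemma card_last_square_at (Sigma : finType) (s : seq Sigma) (i : nat) :
  #|[set p : 'I_(size s) | last_square_at s i p]| <= #|[set c in s]|.
Proof.
set C := [set c in s]; set P := [set p | _]; rewrite leqNgt; apply/negP=> CP.
pose ps := sort leq (map (@nat_of_ord (size s)) (enum P)).
pose p j := nth 0 ps j.
have size_ps : size ps = #|P| by rewrite size_sort size_map -cardE.
have ps_sorted : sorted ltn ps.
  rewrite ltn_sorted_uniq_leq sort_uniq (map_inj_uniq (@ord_inj _)) enum_uniq.
  exact: sort_sorted leq_total _.
have pP j : j <= #|C| -> last_square_at s i (p j).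
  move=> jC; have : p j \in ps by rewrite mem_nth // size_ps; lia.
  by rewrite mem_sort => /mapP[q]; rewrite mem_enum inE => sq ->.
have sq j : j <= #|C| -> square_at s i (p j) by move=> /pP/andP[].
(* A default letter taken from [s] keeps [w] in [C] past the end of the string. *)
have [x0 x0s] : exists x0, x0 \in s.
  have /and3P[p0_gt0 ps0 _] := sq 0 (leq0n _).
  have: 0 < size s by lia.
  by rewrite -has_predT => /hasP[c cs _]; exists c.
pose w t := nth x0 s (i + t).
have wC t : w t \in C.
  rewrite inE /w; have [ts|st] := ltnP (i + t) (size s); first exact: mem_nth.
  by rewrite nth_default.
have [|||d [d_gt0 dp [f fw]]] := @square_recurs _ C w p wC.
- move=> j jC; apply: (sorted_ltn_nth ltn_trans) => //;
    by rewrite inE size_ps; lia.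
- by have /and3P[] := sq 0 (leq0n _).
- by move=> j jC; apply: square_at_perm; apply: sq.
have /and3P[p0_gt0 _ _] := sq 0 (leq0n _).
have /and3P[_ pC _] := sq _ (leqnn #|C|).
have ids : i + d < size s by lia.
have /andP[_ /forallP/(_ (Ordinal ids)) /=] := pP 0 (leq0n _).
have -> : i < i + d by lia.
have -> /= : i + d + (p 0).*2 <= size s by lia.
case/negP; apply/existsP; exists f; apply/eqP/(@eq_from_nth _ x0).
  by rewrite size_map !size_factor //; lia.
rewrite size_map size_factor; last by lia.
move=> t tp; rewrite (nth_map x0) ?size_factor; try lia.
by rewrite !nth_factor // -addnA -/(w (d + t)) fw.
Qed.

(** The rightmost factor equivalent to [u] works: the equivalence restricts to both halves, so that
    factor is again a square. *)
Lemma last_square_class (Sigma : finType) (s u : seq Sigma) :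
  infix u s -> param_square u ->
  exists i p, last_square_at s i p /\ param_equiv u (factor s i p.*2).
Proof.
have /equivalence_relP[eqv_refl eqv_ltr] := @param_equiv_equivalence Sigma.
move=> /infixP[s1 [s2 Ds]] /param_squareP[u_neq0 [x [y [Du xy]]]].
pose p := size x.
have size_y : size y = p by have /existsP[f /eqP <-] := xy; rewrite size_map.
have size_u : size u = p.*2 by rewrite Du size_cat size_y -addnn.
have p_gt0 : 0 < p by case: {Ds Du} u u_neq0 size_u => //= a u _; lia.
pose occ i := (i + p.*2 <= size s) && param_equiv u (factor s i p.*2).
have occ0 : occ (size s1).
  rewrite /occ Ds !size_cat size_u leq_add2l leq_addr /=.
  by rewrite /factor drop_size_cat // -size_u take_size_cat //; apply: eqv_refl.
have occ_le i : occ i -> i <= size s by case/andP; lia.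
have ex_occ : exists i, occ i by exists (size s1).
case: (ex_maxnP ex_occ occ_le) => i /andP[ip ui] imax.
exists i, p; split=> //; apply/andP; split.
  apply/and3P; split=> //; have /existsP[f /eqP] := ui.
  rewrite factor_cat Du map_cat => /eqP.
  rewrite eqseq_cat ?size_map ?size_factor; try lia.
  case/andP=> /eqP fx /eqP fy.
  have xi : param_equiv x (factor s i p) by apply/existsP; exists f; apply/eqP.
  have yi : param_equiv y (factor s (i + p) p).
    by apply/existsP; exists f; apply/eqP.
  by rewrite -(eqv_ltr _ _ xi) (eqv_ltr _ _ xy).
apply/forallP=> j; apply/implyP=> ij; apply/implyP=> jp; apply/negP=> i_j.
have : occ j by rewrite /occ jp (eqv_ltr _ _ ui).
by move/imax; lia.
Qed.

(** * Counting classes by last position *)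

Theorem theorem6 (Sigma : finType) (s : seq Sigma) (s_neq0 : s <> [::]) :
  num_param_squares s < #|[set c in s]| * size s.
Proof.
have /equivalence_relP[_ eqv_ltr] := @param_equiv_equivalence Sigma.
set C := [set c in s]; pose n := size s.
have n_gt0 : 0 < n by rewrite lt0n size_eq0; apply/eqP.
pose Q := [set ip : 'I_n * 'I_n | last_square_at s ip.1 ip.2].
pose cls (ip : 'I_n * 'I_n) := [set v in param_squares_of s |
  param_equiv (factor s ip.1 ip.2.*2) v].
have subQ : num_param_squares s <= #|Q|.
  apply: leq_trans (leq_imset_card cls Q); apply: subset_leq_card.
  apply/subsetP=> _ /imsetP[u + ->]; rewrite inE => /andP[us sq_u].
  have [i [p [ip u_ip]]] := last_square_class us sq_u.
  have /andP[/and3P[p_gt0 ips _] _] := ip.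
  have i_n : i < n by rewrite /n; lia.
  have p_n : p < n by rewrite /n; lia.
  apply/imsetP; exists (Ordinal i_n, Ordinal p_n); first by rewrite inE.
  by apply/setP=> v; rewrite !inE (eqv_ltr _ _ u_ip).
have C_gt0 : 0 < #|C|.
  have /hasP[c cs _] : has predT s by rewrite has_predT.
  by apply/card_gt0P; exists c; rewrite inE.
apply: (leq_ltn_trans subQ).
have -> : #|Q| = \sum_(i < n) #|[set p : 'I_n | last_square_at s i p]|.
  rewrite -sum1_card; under [RHS]eq_bigr do rewrite -sum1_card.
  rewrite pair_big_dep /=; by apply: eq_bigl => -[i p]; rewrite !inE.
(* A square has length at least 2, so none starts at the last position; this gives strictness. *)
have ltm : n.-1 < n by rewrite prednK.
have last0 : #|[set p : 'I_n | last_square_at s n.-1 p]| = 0.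
  apply: eq_card0 => p; rewrite inE; apply/negbTE/negP.
  by case/andP=> /and3P[p_gt0 mp _] _; rewrite -/n in mp; lia.
rewrite (bigD1 (Ordinal ltm)) //= last0 add0n.
have le_sum : \sum_(i < n | i != Ordinal ltm)
    #|[set p : 'I_n | last_square_at s i p]| <= n.-1 * #|C|.
  apply: (@leq_trans (\sum_(i < n | i != Ordinal ltm) #|C|)).
    by apply: leq_sum => i _; apply: card_last_square_at.
  by rewrite sum_nat_const cardC1 card_ord.
by apply: leq_ltn_trans le_sum _; rewrite mulnC ltn_pmul2l.
Qed.
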